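(* Let $\mathfrak{L}$ be a linearly ordered idempotent semifield with $\mathfrak{L}\neq\mathbb{B}$, let $n\geq 1$, and let $A,B\in UT_n(\mathfrak{L}^* )$. Then $CA\;\widetilde{\mathcal{R}}\;CB$ for all $C\in UT_n(\mathfrak{L}^* )$ if and only if $A\;\mathcal{R}\;B$, where $\mathcal{R}$ and $\widetilde{\mathcal{R}}$ are taken in the semigroup $UT_n(\mathfrak{L}^* )$.
   Context: A linearly ordered idempotent semifield is a commutative semiring $\mathfrak{L}$ with $x+x=x$ for all $x$, in which $\mathfrak{L}^*=\mathfrak{L}\setminus\{\mathbf{0}\}$ is an abelian group under multiplication, and in which the order $a\leq b\iff a+b=b$ is total (so addition is maximum). $\mathbb{B}$ is the two-element Boolean semifield. $UT_n(\mathfrak{L}^* )$ is the semigroup (under matrix multiplication) of upper triangular $n\times n$ matrices over $\mathfrak{L}$ all of whose entries on and above the diagonal are non-zero. For a semigroup $T$ (with $T^1$ denoting $T$ with an identity adjoined if necessary): $a\,\mathcal{R}\,b$ iff $aT^1=bT^1$; $a\,\widetilde{\mathcal{R}}\,b$ iff for all idempotents $e\in T$, $ea=a\Leftrightarrow eb=b$. *)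

(* Defs.v *)
From HB Require Import structures.
From mathcomp Require Import all_boot all_order all_algebra.

Set Implicit Arguments.
Unset Strict Implicit.
Unset Printing Implicit Defensive.

Import GRing.Theory.
Local Open Scope ring_scope.

Definition idem_le (L : nmodType) : rel L := fun a b => a + b == b.

(* As [1 != 0] in a [comNzSemiRingType], [sfield_mulV] says exactly that the
   nonzero elements form an abelian group under multiplication; non-triviality
   loses nothing, since a group is nonempty. *)
HB.mixin Record isLinIdemSemifield L of GRing.ComNzSemiRing L := {
  sfield_addxx : forall x : L, x + x = x;
  sfield_mulV : forall x : L, x != 0 -> exists y : L, x * y = 1;
  sfield_le_total : total (@idem_le L)
}.

#[short(type="linIdemSemifieldType")]
HB.structure Definition LinIdemSemifield :=
  { L of GRing.ComNzSemiRing L & isLinIdemSemifield L }.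

(* [bool] itself carries the field structure F_2 in the library, hence the
   alias, whose addition is [orb]. *)
Definition boolean_semifield : Type := bool.

HB.instance Definition _ := Choice.copy boolean_semifield bool.
HB.instance Definition _ :=
  GRing.isNmodule.Build boolean_semifield orbA orbC orFb.
HB.instance Definition _ :=
  GRing.Nmodule_isComNzSemiRing.Build boolean_semifield
    andbA andbC andTb andb_orl andFb isT.

Lemma boolean_semifield_mulV (x : boolean_semifield) :
  x != 0 -> exists y : boolean_semifield, x * y = 1.
Proof. by case: x => // _; exists true. Qed.

Lemma boolean_semifield_le_total : total (@idem_le boolean_semifield).
Proof. by case; case. Qed.

HB.instance Definition _ :=
  isLinIdemSemifield.Build boolean_semifield
    orbb boolean_semifield_mulV boolean_semifield_le_total.

Definition semiring_iso (R S : pzSemiRingType) : Prop :=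
  exists f : {rmorphism R -> S}, bijective f.

Definition is_UT (L : nmodType) (n : nat) : pred 'M[L]_n := fun A =>
  [forall i : 'I_n, forall j : 'I_n, if (i <= j)%N then A i j != 0 else A i j == 0].

(* [UT_mx L n] is UT_n(L^* ). *)
Record UT_mx (L : nmodType) (n : nat) : Type :=
  UTMx { UT_val :> 'M[L]_n; UT_valP : is_UT UT_val }.

HB.instance Definition _ (L : nmodType) (n : nat) :=
  [isSub for @UT_val L n].
HB.instance Definition _ (L : nmodType) (n : nat) :=
  [Choice of UT_mx L n by <:].

Lemma is_UTP (L : nmodType) (n : nat) (A : 'M[L]_n) :
  reflect ((forall i j : 'I_n, (i <= j)%N -> A i j != 0) /\
           (forall i j : 'I_n, (j < i)%N -> A i j = 0))
          (is_UT A).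
Proof.
apply: (iffP forallP) => [UA | [A1 A0] i].
  split=> i j; first by move=> ij; have /forallP/(_ j) := UA i; rewrite ij.
  by rewrite ltnNge => /negPf ij; have /forallP/(_ j) := UA i; rewrite ij => /eqP.
apply/forallP=> j; case: leqP => ij; first exact: A1.
exact/eqP/A0.
Qed.

Lemma idem_add_neq0 (L : linIdemSemifieldType) (x y : L) :
  x != 0 -> x + y != 0.
Proof.
apply: contra_neq => xy0.
by rewrite -(addr0 x) -xy0 addrA sfield_addxx.
Qed.

Lemma sfield_mul_neq0 (L : linIdemSemifieldType) (x y : L) :
  x != 0 -> y != 0 -> x * y != 0.
Proof.
move=> /sfield_mulV[z xz]; apply: contra_neq => xy0.
by rewrite -(mul1r y) -xz mulrAC xy0 mul0r.
Qed.

Lemma is_UT_mulmx (L : linIdemSemifieldType) (n : nat) (A B : 'M[L]_n) :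
  is_UT A -> is_UT B -> is_UT (A *m B).
Proof.
move=> /is_UTP[A1 A0] /is_UTP[B1 B0]; apply/is_UTP; split=> i j ij; rewrite mxE.
  by rewrite (bigD1 i) //= idem_add_neq0 // sfield_mul_neq0 ?A1 ?B1.
rewrite big1 // => k _; case: (ltnP k i) => ki; first by rewrite A0 ?mul0r.
by rewrite B0 ?mulr0 // (leq_trans ij).
Qed.

Definition UT_mul (L : linIdemSemifieldType) (n : nat) (A B : UT_mx L n) :
  UT_mx L n := UTMx (is_UT_mulmx (UT_valP A) (UT_valP B)).

Lemma UT_mulA (L : linIdemSemifieldType) (n : nat) :
  associative (@UT_mul L n).
Proof. by move=> A B C; apply/val_inj; rewrite /= mulmxA. Qed.

HB.instance Definition _ (L : linIdemSemifieldType) (n : nat) :=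
  isSemigroup.Build (UT_mx L n) (@UT_mulA L n).

(* [a T^1] is [{a} ∪ a T], whether or not [T] has an identity. *)
Definition right_ideal1 (T : semigroupType) (a : T) : T -> Prop :=
  fun x => x = a \/ exists t : T, x = (a * t)%g.

Definition greenR (T : semigroupType) (a b : T) : Prop :=
  forall x : T, right_ideal1 a x <-> right_ideal1 b x.

Definition greenRtilde (T : semigroupType) (a b : T) : Prop :=
  forall e : T, (e * e)%g = e -> ((e * a)%g = a <-> (e * b)%g = b).

(* Main.v *)
Require Import Defs.
From mathcomp Require Import all_boot all_order all_algebra.

(** Only one implication has content: Green's relation R is a left congruence
    contained in its tilde version.

    For the converse, fix [A] and [B] and suppose that every idempotent fixing
    [C * B] on the left also fixes [C * A], whatever [C] is; it is enough to
    deduce that [A] lies in the right ideal of [B].  By residuation there is a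
    greatest [X] with [B * X <= A], namely [UT_residual B A], whose entries
    [X l j] are the minima over [k <= l] of the ratios [A k j / B k l].  So [A]
    is a right multiple of [B] as soon as [A i j <= (B * X) i j] for [i <= j].

    Were this to fail, column [j] of [A] would be outside the span of the
    columns of [B], and a two-row inequality would separate them: two row
    vectors [c] and [d] with [d b <= c b] for all columns [b] of [B], but not
    for column [j] of [A].  With [t := (B * X) i j], one can take
    [c k := t / A k j], and [d] equal to [c] except that its entry [i] is [1]
    (that is, [A i j / A i j]): the inequality holds on the columns of [B]
    because each [X l j] is an attained minimum, while [c] and [d] take the
    values [t] and [A i j] on column [j] of [A].  These vectors are made rows
    [0] and [i] of a triangular matrix [C] ([separating_UT]); this is possible
    when [i != 0], and in row [0] the equality [B * X = A] holds anyway
    ([residual_mul_row0]).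

    It remains to detect a row inequality by an idempotent.  The greatest [E]
    with [E * M <= M], [left_unit_UT M], is idempotent, fixes [M], and satisfies
    [1 <= E p q] exactly when row [q] of [M] is below row [p].  Applied to
    [M := C * B], it fixes [C * A] too, so row [i] of [C * A] is below its row
    [0]; in column [j] this says [A i j <= t]. *)

Set Implicit Arguments.
Unset Strict Implicit.
Unset Printing Implicit Defensive.

Import GRing.Theory.
Local Open Scope ring_scope.

Local Notation "x <=+ y" := (idem_le x y) (at level 70, no associativity).

(** * Order and residuation in a linearly ordered idempotent semifield *)

Section Semifield.

Variable L : linIdemSemifieldType.
Implicit Types x y z : L.

Lemma idem_le_refl x : x <=+ x.
Proof. by rewrite /idem_le sfield_addxx. Qed.

Lemma idem_le0 x : 0 <=+ x.
Proof. by rewrite /idem_le add0r. Qed.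

Lemma idem_le_trans y x z : x <=+ y -> y <=+ z -> x <=+ z.
Proof.
by rewrite /idem_le => /eqP xy /eqP yz; rewrite -yz addrA xy.
Qed.

Lemma idem_le_anti x y : x <=+ y -> y <=+ x -> x = y.
Proof. by rewrite /idem_le => /eqP xy /eqP yx; rewrite -xy addrC yx. Qed.

Lemma idem_le_mul x1 y1 x2 y2 :
  x1 <=+ y1 -> x2 <=+ y2 -> x1 * x2 <=+ y1 * y2.
Proof.
move=> /eqP h1 /eqP h2; apply: (@idem_le_trans (y1 * x2)).
  by rewrite /idem_le -mulrDl h1.
by rewrite /idem_le -mulrDr h2.
Qed.

Lemma term_le_sum (I : finType) (F : I -> L) i : F i <=+ \sum_k F k.
Proof. by rewrite /idem_le (bigD1 i) //= addrA sfield_addxx. Qed.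

Lemma sum_le (I : finType) (F : I -> L) y :
  (forall i, F i <=+ y) -> \sum_i F i <=+ y.
Proof.
move=> Fy; apply: (big_ind (fun x => x <=+ y)) => //; first exact: idem_le0.
by rewrite /idem_le => x z /eqP xy /eqP zy; rewrite -addrA zy xy.
Qed.

Lemma sum_attained (I : finType) (F : I -> L) :
  \sum_i F i != 0 -> exists i, \sum_i F i = F i.
Proof.
suff [->|//] : \sum_i F i = 0 \/ exists i, \sum_i F i = F i.
  by rewrite eqxx.
apply: (big_ind (fun x => x = 0 \/ exists i, x = F i)); first by left.
  move=> x y hx hy.
  by case/orP: (sfield_le_total x y) => /eqP; [|rewrite addrC] => ->.
by move=> i _; right; exists i.
Qed.

Lemma sinv_subproof x : exists y, (x == 0) || (x * y == 1).
Proof.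
case: eqVneq => [_|/sfield_mulV[y xy]]; first by exists 0.
by exists y; rewrite xy eqxx.
Qed.

(** The value at [0] is unspecified. *)
Definition sinv x : L := xchoose (sinv_subproof x).

Lemma mul_sinv x : x != 0 -> x * sinv x = 1.
Proof.
move=> /negPf x0.
by case/orP: (xchooseP (sinv_subproof x)) => [|/eqP//]; rewrite x0.
Qed.

Lemma sinv_neq0 x : x != 0 -> sinv x != 0.
Proof.
move=> x0; apply: contra_neq (oner_neq0 L) => xV0.
by rewrite -(mul_sinv x0) xV0 mulr0.
Qed.

Section Residual.

Variables (I : finType) (u v : I -> L).
Hypothesis u_neq0 : exists i, u i != 0.
Hypothesis supp_uv : forall i, u i != 0 -> v i != 0.

(** The minimum of the ratios [v i / u i] over the support of [u], written as
    the inverse of a maximum; it is the greatest [r] with [r * u i <= v i] for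
    all [i]. *)
Definition residual : L := sinv (\sum_i u i * sinv (v i)).

Lemma residual_sum_neq0 : \sum_i u i * sinv (v i) != 0.
Proof.
have [i ui] := u_neq0; rewrite (bigD1 i) //= idem_add_neq0 //.
by rewrite sfield_mul_neq0 // sinv_neq0 // supp_uv.
Qed.

Lemma residual_neq0 : residual != 0.
Proof. exact/sinv_neq0/residual_sum_neq0. Qed.

Lemma residual_mul_le i : residual * u i <=+ v i.
Proof.
have [->|ui] := eqVneq (u i) 0; first by rewrite mulr0 idem_le0.
have -> : u i = u i * sinv (v i) * v i.
  by rewrite -mulrA [sinv _ * _]mulrC mul_sinv ?mulr1 ?supp_uv.
rewrite mulrA -[X in _ <=+ X]mul1r -(mul_sinv residual_sum_neq0).
rewrite [X in _ <=+ X * _]mulrC.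
apply: idem_le_mul (idem_le_refl _); apply: idem_le_mul (idem_le_refl _) _.
exact: (term_le_sum (fun k => u k * sinv (v k))).
Qed.

Lemma residual_attained : exists2 i, u i != 0 & residual * u i = v i.
Proof.
have [i def_i] := sum_attained residual_sum_neq0.
have ui : u i != 0.
  by apply: contra_neq residual_sum_neq0; rewrite def_i => ->; rewrite mul0r.
exists i => //; rewrite -[RHS]mul1r -(mul_sinv residual_sum_neq0) -/residual.
rewrite def_i mulrAC -[u i * _ * _]mulrA [sinv _ * v i]mulrC.
by rewrite mul_sinv ?supp_uv // mulr1 mulrC.
Qed.

Lemma le_residual r : (forall i, r * u i <=+ v i) -> r <=+ residual.
Proof.
move=> r_le; have [i ui def_v] := residual_attained.
have := idem_le_mul (r_le i) (idem_le_refl (sinv (u i))).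
by rewrite -def_v -!mulrA mul_sinv // !mulr1.
Qed.

End Residual.

(** * Residuation of triangular matrices *)

Section Triangular.

Variable n : nat.
Implicit Types A B C M N : UT_mx L n.
Implicit Types i j k l p q : 'I_n.

Lemma UT_neq0 A i j : (i <= j)%N -> A i j != 0.
Proof. by have /is_UTP[h _] := UT_valP A; apply: h. Qed.

Lemma UT_eq0 A i j : (j < i)%N -> A i j = 0.
Proof. by have /is_UTP[_ h] := UT_valP A; apply: h. Qed.

Lemma UT_neq0P A i j : A i j != 0 -> (i <= j)%N.
Proof. by apply: contraR; rewrite -ltnNge => ji; rewrite UT_eq0. Qed.

Lemma UT_mulE A B i j : (A * B)%g i j = \sum_k A i k * B k j.
Proof. by rewrite /= mxE. Qed.

Lemma UT_ext A B : (forall i j, (i <= j)%N -> A i j = B i j) -> A = B.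
Proof.
move=> AB; apply/val_inj/matrixP => i j.
by case: (leqP i j) => ij; [exact: AB | rewrite !UT_eq0].
Qed.

Lemma term_le_mul A B i j k : A i k * B k j <=+ (A * B)%g i j.
Proof. by rewrite UT_mulE (term_le_sum (fun k => A i k * B k j)). Qed.

Section UpperPart.

Variable f : 'I_n -> 'I_n -> L.
Hypothesis f_neq0 : forall i j, (i <= j)%N -> f i j != 0.

Lemma upper_part_subproof :
  is_UT (\matrix_(i, j) if (i <= j)%N then f i j else 0).
Proof.
apply/is_UTP; split=> i j ij; rewrite mxE; first by rewrite ij f_neq0.
by rewrite leqNgt ij.
Qed.

Definition upper_part : UT_mx L n := UTMx upper_part_subproof.

Lemma upper_partE i j : upper_part i j = if (i <= j)%N then f i j else 0.
Proof. by rewrite /= mxE. Qed.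

End UpperPart.

Lemma col_residual_supp A B l j : (l <= j)%N ->
  (exists k, B k l != 0) /\ (forall k, B k l != 0 -> A k j != 0).
Proof.
move=> lj; split; first by exists l; rewrite UT_neq0.
by move=> k /UT_neq0P kl; rewrite UT_neq0 // (leq_trans kl).
Qed.

Lemma row_residual_supp M p q : (p <= q)%N ->
  (exists l, M q l != 0) /\ (forall l, M q l != 0 -> M p l != 0).
Proof.
move=> pq; split; first by exists q; rewrite UT_neq0.
by move=> l /UT_neq0P ql; rewrite UT_neq0 // (leq_trans pq).
Qed.

Lemma UT_residual_neq0 A B l j : (l <= j)%N ->
  residual (B^~ l) (A^~ j) != 0.
Proof. by move=> /(col_residual_supp A B)[h1 h2]; exact: residual_neq0. Qed.

Lemma left_unit_neq0 M p q : (p <= q)%N -> residual (M q) (M p) != 0.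
Proof. by move=> /(row_residual_supp M)[h1 h2]; exact: residual_neq0. Qed.

(** The greatest [X] with [B * X <= A]. *)
Definition UT_residual B A : UT_mx L n := upper_part (@UT_residual_neq0 A B).

(** The greatest [E] with [E * M <= M]. *)
Definition left_unit_UT M : UT_mx L n := upper_part (@left_unit_neq0 M).

Lemma mul_UT_residual_le A B i j : (B * UT_residual B A)%g i j <=+ A i j.
Proof.
rewrite UT_mulE; apply: sum_le => l; rewrite upper_partE.
case: leqP => [/(col_residual_supp A B)[h1 h2]|_]; last first.
  by rewrite mulr0 idem_le0.
by rewrite mulrC (residual_mul_le h1 h2).
Qed.

Lemma UT_residual_attained A B l j : (l <= j)%N ->
  exists2 k : 'I_n, (k <= l)%N & UT_residual B A l j * B k l = A k j.
Proof.
move=> lj; have [h1 h2] := col_residual_supp A B lj.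
have [k /UT_neq0P kl def_A] := residual_attained h1 h2.
by exists k => //; rewrite upper_partE lj.
Qed.

(** The residual [X 0 j] involves the single ratio [A 0 j / B 0 0], since
    column [0] of [B] has no other nonzero entry. *)
Lemma residual_mul_row0 A B i j : i = 0%N :> nat ->
  A i j <=+ (B * UT_residual B A)%g i j.
Proof.
move=> i0; have [|k] := @UT_residual_attained A B i j; first by rewrite i0.
rewrite i0 leqn0 -i0 => /eqP/val_inj -> <-.
by rewrite mulrC term_le_mul.
Qed.

Lemma left_unit_mul_le M p q l : left_unit_UT M p q * M q l <=+ M p l.
Proof.
rewrite upper_partE; case: leqP => [/(row_residual_supp M)[h1 h2]|_].
  exact: (residual_mul_le h1 h2).
by rewrite mul0r idem_le0.
Qed.

Lemma le_left_unit M p q r : (p <= q)%N ->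
  (forall l, r * M q l <=+ M p l) -> r <=+ left_unit_UT M p q.
Proof.
move=> pq r_le; have [h1 h2] := row_residual_supp M pq.
by rewrite upper_partE pq; apply: (le_residual h1 h2).
Qed.

Lemma left_unit_diag M p : 1 <=+ left_unit_UT M p p.
Proof. by apply: le_left_unit => // l; rewrite mul1r idem_le_refl. Qed.

Lemma le_left_unit_mul M N p q : N p q <=+ (left_unit_UT M * N)%g p q.
Proof.
apply: idem_le_trans (term_le_mul _ _ _ _ p).
by rewrite -{1}[N p q]mul1r idem_le_mul ?left_unit_diag ?idem_le_refl.
Qed.

Lemma left_unitP M : (left_unit_UT M * M)%g = M.
Proof.
apply: UT_ext => p q _; apply: idem_le_anti (le_left_unit_mul _ _ _ _).
by rewrite UT_mulE; apply: sum_le => k; apply: left_unit_mul_le.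
Qed.

(** [E * E] also satisfies [E * E * M <= M], so maximality of [E] bounds it. *)
Lemma left_unit_idem M : (left_unit_UT M * left_unit_UT M)%g = left_unit_UT M.
Proof.
apply: UT_ext => p q pq; apply: idem_le_anti (le_left_unit_mul _ _ _ _).
rewrite UT_mulE; apply: sum_le => k; apply: le_left_unit => // l.
rewrite -mulrA; apply: idem_le_trans (left_unit_mul_le _ _ k _).
by rewrite idem_le_mul ?idem_le_refl ?left_unit_mul_le.
Qed.

(** Fixing [N] by the greatest left unit of [M] forces every inequality between
    two rows of [M] to hold between the same rows of [N]. *)
Lemma left_unit_transfer M N p q l : (p <= q)%N ->
  (forall k, M q k <=+ M p k) -> (left_unit_UT M * N)%g = N ->
  N q l <=+ N p l.
Proof.
move=> pq Mqp EN; have := term_le_mul (left_unit_UT M) N p l q; rewrite EN.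
apply: idem_le_trans.
rewrite -{1}[N q l]mul1r; apply: idem_le_mul (idem_le_refl _).
by apply: le_left_unit => // k; rewrite mul1r.
Qed.

(** * Separating a column from the span of the columns of a matrix *)

Section Separation.

Variables (A B : UT_mx L n) (i j : 'I_n).
Hypothesis le_ij : (i <= j)%N.

Let X := UT_residual B A.
Let t := (B * X)%g i j.

(** Up to [j], the inverse of column [j] of [A], scaled so that the pairing with
    that column is [t].  The indices beyond [j] do not meet column [j]; there
    the weights are just large enough to dominate row [i] of [B]. *)
Definition sep_weight (k : 'I_n) : L :=
  if (k <= j)%N then t * sinv (A k j) else B i k * sinv (B k k).

Lemma sep_weight_neq0 k : sep_weight k != 0.
Proof.
rewrite /sep_weight; case: leqP => kj; rewrite sfield_mul_neq0 ?sinv_neq0 //;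
  by rewrite UT_neq0 // (leq_trans le_ij) // ltnW.
Qed.

Definition sep_entry (p k : 'I_n) : L :=
  if (p == i) && (k == i) then 1 else sep_weight k.

Lemma sep_entry_neq0 p k : (p <= k)%N -> sep_entry p k != 0.
Proof.
by rewrite /sep_entry; case: ifP; rewrite ?oner_neq0 ?sep_weight_neq0.
Qed.

Definition separating_UT : UT_mx L n := upper_part sep_entry_neq0.

Variable z : 'I_n.
Hypotheses (z0 : z = 0%N :> nat) (zi : z != i).

Lemma separating_row0 k : separating_UT z k = sep_weight k.
Proof. by rewrite upper_partE z0 /= /sep_entry (negPf zi). Qed.

Lemma separating_mul_col :
  (separating_UT * A)%g z j <=+ t /\ A i j <=+ (separating_UT * A)%g i j.
Proof.
split.
  rewrite UT_mulE; apply: sum_le => k; rewrite separating_row0 /sep_weight.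
  case: leqP => kj; last by rewrite [A k j]UT_eq0 // mulr0 idem_le0.
  by rewrite -mulrA [sinv _ * _]mulrC mul_sinv ?UT_neq0 // mulr1 idem_le_refl.
apply: idem_le_trans (term_le_mul _ _ _ _ i).
by rewrite upper_partE leqnn /sep_entry eqxx mul1r idem_le_refl.
Qed.

(** When [l <= j], an index [k] where the ratio [X l j] is attained gives
    [sep_weight k * B k l = t / X l j], and [B i l * X l j <= t]. *)
Lemma le_separating_row0 l : B i l <=+ (separating_UT * B)%g z l.
Proof.
case: (leqP l j) => [lj | jl]; last first.
  apply: idem_le_trans (term_le_mul _ _ _ _ l).
  rewrite separating_row0 /sep_weight leqNgt jl /= -mulrA [sinv _ * _]mulrC.
  by rewrite mul_sinv ?UT_neq0 // mulr1 idem_le_refl.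
have [k kl def_A] := UT_residual_attained A B lj.
apply: idem_le_trans (term_le_mul _ _ _ _ k).
have Akj : A k j != 0 by rewrite UT_neq0 // (leq_trans kl).
rewrite separating_row0 /sep_weight (leq_trans kl lj).
have -> : B i l = B i l * X l j * sinv (A k j) * B k l.
  rewrite -!mulrA [sinv _ * _]mulrC [X l j * _]mulrA def_A.
  by rewrite mul_sinv // mulr1.
by do 2!apply: idem_le_mul (idem_le_refl _); apply: term_le_mul.
Qed.

Lemma separating_mul_rows l :
  (separating_UT * B)%g i l <=+ (separating_UT * B)%g z l.
Proof.
rewrite [X in X <=+ _]UT_mulE; apply: sum_le => k; rewrite upper_partE.
case: leqP => _; last by rewrite mul0r idem_le0.
rewrite /sep_entry eqxx /=; case: eqVneq => [->|_].
  by rewrite mul1r le_separating_row0.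
by rewrite -separating_row0 term_le_mul.
Qed.

End Separation.

(** The test matrices [C] depend on the entry [(i, j)]: they are the separating
    matrices, whose rows [0] and [i] are compared in column [j]. *)
Lemma right_multiple_of_fixed A B :
  (forall C e : UT_mx L n,
     (e * e)%g = e -> (e * (C * B))%g = (C * B)%g ->
     (e * (C * A))%g = (C * A)%g) ->
  A = (B * UT_residual B A)%g.
Proof.
move=> fixBA; apply: UT_ext => i j ij.
apply: idem_le_anti (mul_UT_residual_le _ _ _ _).
have n_gt0 : (0 < n)%N by apply: leq_ltn_trans (ltn_ord i).
pose z := Ordinal n_gt0.
have [<-|zi] := eqVneq z i; first exact: residual_mul_row0.
pose C := separating_UT A B ij.
have [CA_t A_CA] := @separating_mul_col A B i j ij z erefl zi.
apply: idem_le_trans A_CA (idem_le_trans _ CA_t).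
apply: (@left_unit_transfer (C * B)%g) => //.
  by move=> k; apply: separating_mul_rows.
by apply: fixBA; rewrite ?left_unit_idem ?left_unitP.
Qed.

End Triangular.
End Semifield.

(** * Green's relation and the theorem *)

Lemma right_ideal1_fixed (T : semigroupType) (a b c e : T) :
  right_ideal1 b a -> (e * (c * b))%g = (c * b)%g ->
  (e * (c * a))%g = (c * a)%g.
Proof.
by case=> [->|[t ->]] // ecb; rewrite !mulgA -[(e * c * b)%g]mulgA ecb.
Qed.

Lemma greenR_mul (T : semigroupType) (a b x y : T) :
  a = (b * x)%g -> b = (a * y)%g -> greenR a b.
Proof.
move=> def_a def_b c; split=> -[->|[t ->]]; right.
- by exists x.
- by exists (x * t)%g; rewrite mulgA -def_a.
- by exists y.
- by exists (y * t)%g; rewrite mulgA -def_b.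
Qed.

Theorem proposition6p10 (L : linIdemSemifieldType) (n : nat) (A B : UT_mx L n) :
  ~ semiring_iso L boolean_semifield ->
  (1 <= n)%N ->
  (forall C : UT_mx L n, greenRtilde (C * A)%g (C * B)%g) <-> greenR A B.
Proof.
move=> _ _; split=> [tildeAB | RAB C e _].
  apply: (@greenR_mul _ A B (UT_residual B A) (UT_residual A B));
    apply: right_multiple_of_fixed => C e ee; apply (tildeAB C e ee).
split; apply: right_ideal1_fixed; apply/RAB; exact: or_introl.
Qed.
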